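(* Let $(X,r)$ be any relation in an elementary topos $\mathcal E$. Then for every generalized element $\langle a,s\rangle\colon W\to X\times PX$, $$W\Vdash a\in_X\mathsf{cl}(s)\quad\text{if, and only if,}\quad W\Vdash\exists y\,\big((a\le_r y)\wedge(y\in_X s)\big),$$ where $y$ is a variable of type $X$.
   Context: Topos notation. $\top\colon 1\to\Omega$ is the subobject classifier, $\top_W\colon W\to 1\to\Omega$. $PX$ is the power object of $X$ with membership morphism $\in_X\colon X\times PX\to\Omega$; each $g\colon X\times Y\to\Omega$ has a unique transpose $\hat g\colon Y\to PX$ with $\in_X\circ(1\times\hat g)=g$. For $\langle x,s\rangle\colon W\to X\times PX$ write $x\in_X s$ for $\in_X\circ\langle x,s\rangle\colon W\to\Omega$. The direct image $\exists_f\colon PA\to PB$ of $f\colon A\to B$ is the transpose of the classifying morphism of the image of $(f\times 1)m\colon U_A\to B\times PA$, where $m\colon U_A\rightarrowtail A\times PA$ is the subobject classified by $\in_A$. Each $PX$ is an internal Heyting algebra with order the equalizer of meet and first projection. Relations. A relation $(X,r)$ is a monomorphism $r\colon R\rightarrowtail X\times X$ (not assumed reflexive or transitive) with classifying morphism $\le_r\colon X\times X\to\Omega$. $\downarrow\colon X\to PX$ is the transpose of $\le_r$, so $(a\in_X\downarrow b)=(a\le_r b)$. Likewise $PX$ with its own order has $\downarrow\colon PX\to P^2X$, and $\bigvee\colon P^2X\to PX$ is the internal left adjoint of the latter. The closure operator is $\mathsf{cl}:=\bigvee\circ\exists_\downarrow\colon PX\to P^2X\to PX$, with $\exists_\downarrow$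 the direct image of $\downarrow\colon X\to PX$. Forcing. For $\phi\colon Z\to\Omega$ and $a\colon W\to Z$, $W\Vdash\phi(a)$ means $\phi\circ a=\top_W$. For $\psi\colon Z\times Y\to\Omega$, $\exists y\,\psi\colon Z\to\Omega$ is the transpose $Z\to PY$ of $\psi$ followed by the direct image $\exists_Y\colon PY\to P1\cong\Omega$ along $Y\to 1$. Equivalently, $W\Vdash\exists y\,\psi(a,y)$ iff there are an epimorphism $p\colon V\twoheadrightarrow W$ and $b\colon V\to Y$ with $V\Vdash\psi(ap,b)$. *)

(* Defs.v *)
From Corelib Require Import ssreflect.
From Stdlib Require Import Setoid.

Set Implicit Arguments.
Unset Strict Implicit.
Unset Printing Implicit Defensive.

Declare Scope topos_scope.
Delimit Scope topos_scope with topos.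
Open Scope topos_scope.

Record category := Category {
  obj :> Type;
  hom : obj -> obj -> Type;
  idm : forall A, hom A A;
  comp : forall A B C, hom B C -> hom A B -> hom A C;
  comp1m : forall A B (f : hom A B), comp (idm B) f = f;
  compm1 : forall A B (f : hom A B), comp f (idm A) = f;
  compA : forall A B C D (h : hom C D) (g : hom B C) (f : hom A B),
    comp (comp h g) f = comp h (comp g f)
}.
Arguments idm {c} A.

Notation "A ~> B" := (hom A B) (at level 70, no associativity) : topos_scope.
Notation "g ∘ f" := (comp g f) (at level 40, left associativity) : topos_scope.

Definition mono {C : category} {A B : C} (m : A ~> B) : Prop :=
  forall (W : C) (f g : W ~> A), m ∘ f = m ∘ g -> f = g.

(*   A --q--> D
     |p       |g
     B --f--> E   *)
Definition is_pullback {C : category} {A B D E : C}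
    (p : A ~> B) (q : A ~> D) (f : B ~> E) (g : D ~> E) : Prop :=
  f ∘ p = g ∘ q /\
  forall (W : C) (b : W ~> B) (d : W ~> D), f ∘ b = g ∘ d ->
    exists! u : W ~> A, p ∘ u = b /\ q ∘ u = d.

(* The image of f as the least subobject of B through which f factors. *)
Record image_of {C : category} {A B : C} (f : A ~> B) := ImageOf {
  im_obj : C;
  im_mor : im_obj ~> B;
  im_mono : mono im_mor;
  im_factor : exists e : A ~> im_obj, im_mor ∘ e = f;
  im_least : forall (J : C) (j : J ~> B), mono j ->
    (exists e : A ~> J, j ∘ e = f) -> exists h : im_obj ~> J, j ∘ h = im_mor
}.
Arguments im_mono {C A B f} i : rename.

(* Finite limits, from a terminal object, binary products and equalizers. *)
Record lex_category := LexCategory {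
  lex_cat :> category;
  one : lex_cat;
  bang : forall A : lex_cat, A ~> one;
  bang_uniq : forall (A : lex_cat) (f : A ~> one), f = bang A;
  prod : lex_cat -> lex_cat -> lex_cat;
  fst_ : forall A B : lex_cat, prod A B ~> A;
  snd_ : forall A B : lex_cat, prod A B ~> B;
  pair_ : forall W A B : lex_cat, W ~> A -> W ~> B -> W ~> prod A B;
  fst_pair : forall (W A B : lex_cat) (f : W ~> A) (g : W ~> B),
    fst_ A B ∘ pair_ f g = f;
  snd_pair : forall (W A B : lex_cat) (f : W ~> A) (g : W ~> B),
    snd_ A B ∘ pair_ f g = g;
  pair_uniq : forall (W A B : lex_cat) (h : W ~> prod A B),
    h = pair_ (fst_ A B ∘ h) (snd_ A B ∘ h);
  eq_obj : forall A B : lex_cat, A ~> B -> A ~> B -> lex_cat;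
  eq_mor : forall (A B : lex_cat) (f g : A ~> B), eq_obj f g ~> A;
  eq_equalizes : forall (A B : lex_cat) (f g : A ~> B),
    f ∘ eq_mor f g = g ∘ eq_mor f g;
  eq_univ : forall (A B : lex_cat) (f g : A ~> B) (W : lex_cat) (h : W ~> A),
    f ∘ h = g ∘ h -> exists! u : W ~> eq_obj f g, eq_mor f g ∘ u = h
}.
Arguments one {l}.
Arguments bang {l} A.
Arguments fst_ {l A B}.
Arguments snd_ {l A B}.

Notation "1" := one : topos_scope.
Notation "A × B" := (prod A B) (at level 40, left associativity) : topos_scope.
Notation "⟨ f , g ⟩" := (pair_ f g) (at level 0, f at level 99, g at level 99)
  : topos_scope.

Definition cross {C : lex_category} {A A' B B' : C}
    (f : A ~> A') (g : B ~> B') : A × B ~> A' × B' :=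
  ⟨f ∘ fst_, g ∘ snd_⟩.

Lemma eq_mor_mono (C : lex_category) (A B : C) (f g : A ~> B) :
  mono (eq_mor f g).
Proof.
move=> W u v euv.
have [|w [_ w_uniq]] := eq_univ (f := f) (g := g) (h := eq_mor f g ∘ v).
  by rewrite -!compA eq_equalizes.
by rewrite -(w_uniq _ euv) -(w_uniq v eq_refl).
Qed.

(* An elementary topos: finite limits, a subobject classifier and power
   objects, all as chosen structure.  By [chi_uniq] the chosen [chi] is
   independent of the proof that its argument is a monomorphism. *)
Record topos := Topos {
  topos_lex :> lex_category;
  Omega : topos_lex;
  top : (1 : topos_lex) ~> Omega;
  chi : forall (R A : topos_lex) (m : R ~> A), mono m -> A ~> Omega;
  chi_pullback : forall (R A : topos_lex) (m : R ~> A) (hm : mono m),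
    is_pullback m (bang R) (chi hm) top;
  chi_uniq : forall (R A : topos_lex) (m : R ~> A) (hm : mono m)
    (phi : A ~> Omega), is_pullback m (bang R) phi top -> phi = chi hm;
  P : topos_lex -> topos_lex;
  mem : forall X : topos_lex, X × P X ~> Omega;
  transpose : forall X Y : topos_lex, X × Y ~> Omega -> Y ~> P X;
  mem_transpose : forall (X Y : topos_lex) (g : X × Y ~> Omega),
    mem X ∘ cross (idm X) (transpose g) = g;
  transpose_uniq : forall (X Y : topos_lex) (g : X × Y ~> Omega) (h : Y ~> P X),
    mem X ∘ cross (idm X) h = g -> h = transpose g
}.
Arguments Omega {t}.
Arguments top {t}.
Arguments P {t} X.
Arguments mem {t} X.

Definition true_ {E : topos} (W : E) : W ~> Omega := top ∘ bang W.

Definition forces {E : topos} {Z W : E} (phi : Z ~> Omega) (a : W ~> Z) : Prop :=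
  phi ∘ a = true_ W.

Definition member {E : topos} {W X : E} (x : W ~> X) (s : W ~> P X) : W ~> Omega :=
  mem X ∘ ⟨x, s⟩.

(* The pullback of [top] along phi, as an equalizer. *)
Definition sub_of {E : topos} {A : E} (phi : A ~> Omega) : eq_obj phi (true_ A) ~> A :=
  eq_mor phi (true_ A).

Lemma top_top_mono (E : topos) : mono ⟨@top E, top⟩.
Proof. by move=> W f g _; rewrite (bang_uniq f) (bang_uniq g). Qed.

Definition conj_op (E : topos) : Omega × Omega ~> @Omega E := chi (@top_top_mono E).

Definition conj_ {E : topos} {Z : E} (phi psi : Z ~> Omega) : Z ~> Omega :=
  conj_op E ∘ ⟨phi, psi⟩.

Record relation {E : topos} (X : E) := Relation {
  rel_obj : E;
  rel_mor : rel_obj ~> X × X;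
  rel_mono : mono rel_mor
}.
Arguments rel_mono {E X} r : rename.

Definition le {E : topos} {X : E} (r : relation X) : X × X ~> Omega :=
  chi (rel_mono r).

Definition leq {E : topos} {X W : E} (r : relation X) (x y : W ~> X) : W ~> Omega :=
  le r ∘ ⟨x, y⟩.

Definition down {E : topos} {X : E} (r : relation X) : X ~> P X :=
  transpose (le r).

Definition meet {E : topos} (X : E) : P X × P X ~> P X :=
  transpose (conj_ (member (fst_ : X × (P X × P X) ~> X) (fst_ ∘ snd_))
                  (member fst_ (snd_ ∘ snd_))).

Definition pow_order {E : topos} (X : E) : relation (P X) :=
  Relation (@eq_mor_mono _ _ _ (meet X) fst_).

(* j is left adjoint to d for the orders r and r': as morphisms A × B ~> Omega,
   (j a <= b) and (a <= d b) coincide. *)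
Definition internal_left_adjoint {E : topos} {A B : E}
    (r : relation A) (r' : relation B) (j : A ~> B) (d : B ~> A) : Prop :=
  le r' ∘ cross j (idm B) = le r ∘ cross (idm A) d.

(* Images and the left adjoint of [down] exist in every topos; they are built
   below by quantifying over generalized elements, and then used only through
   their universal properties. *)

Section Existence.
Variable E : topos.

Lemma pair_comp (V W A B : E) (f : W ~> A) (g : W ~> B) (t : V ~> W) :
  ⟨f, g⟩ ∘ t = ⟨f ∘ t, g ∘ t⟩.
Proof. by rewrite [LHS]pair_uniq -!compA fst_pair snd_pair. Qed.

Lemma cross_pair (W A A' B B' : E) (f : A ~> A') (g : B ~> B')
    (a : W ~> A) (b : W ~> B) : cross f g ∘ ⟨a, b⟩ = ⟨f ∘ a, g ∘ b⟩.
Proof. by rewrite /cross pair_comp !compA fst_pair snd_pair. Qed.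

Lemma true_comp (V W : E) (t : V ~> W) : true_ W ∘ t = true_ V.
Proof. by rewrite /true_ compA (bang_uniq (bang W ∘ t)). Qed.

Lemma forces_comp (V W Z : E) (phi : Z ~> Omega) (a : W ~> Z) (t : V ~> W) :
  forces phi a -> forces phi (a ∘ t).
Proof. by rewrite /forces -compA => ->; rewrite true_comp. Qed.

Lemma forces_chi (R A W : E) (m : R ~> A) (hm : mono m) (a : W ~> A) :
  forces (chi hm) a <-> exists u, m ∘ u = a.
Proof.
have [e univ] := chi_pullback hm; split=> [/univ [u [[mu _] _]]|[u <-]].
  by exists u.
by rewrite /forces -compA e compA (bang_uniq (bang R ∘ u)).
Qed.

Lemma forces_sub_of (A W : E) (phi : A ~> Omega) (a : W ~> A) :
  forces phi a <-> exists u, sub_of phi ∘ u = a.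
Proof.
split=> [phia|[u <-]].
  have [|u [mu _]] := eq_univ (f := phi) (g := true_ A) (h := a).
    by rewrite true_comp.
  by exists u.
by rewrite /forces -compA eq_equalizes compA true_comp.
Qed.

Lemma chi_eq (R A : E) (m : R ~> A) (hm : mono m) (phi : A ~> Omega) :
  (forall W (a : W ~> A), forces phi a <-> exists u, m ∘ u = a) -> phi = chi hm.
Proof.
move=> phiP; apply: chi_uniq; split.
  by apply/phiP; exists (idm R); rewrite compm1.
move=> W a d e; have [|u mu] := proj1 (phiP W a).
  by rewrite /forces e (bang_uniq d).
exists u; split; first by split; rewrite ?(bang_uniq d) // (bang_uniq (_ ∘ u)).
by move=> v [mv _]; apply: hm; rewrite mu mv.
Qed.

Lemma Omega_ext (A : E) (phi psi : A ~> Omega) :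
  (forall W (a : W ~> A), forces phi a <-> forces psi a) -> phi = psi.
Proof.
move=> eqv; rewrite (@chi_eq _ _ _ (@eq_mor_mono _ _ _ psi (true_ A)) phi).
  by move=> W a; apply: iff_trans (eqv W a) _; exact: forces_sub_of.
by symmetry; apply: chi_eq => W a; exact: forces_sub_of.
Qed.

Lemma forces_conj (Z W : E) (phi psi : Z ~> Omega) (a : W ~> Z) :
  forces (conj_ phi psi) a <-> forces phi a /\ forces psi a.
Proof.
rewrite /forces /conj_ compA pair_comp.
split=> [/forces_chi [u]|[-> ->]].
  rewrite pair_comp => e.
  have := f_equal (fun h => fst_ ∘ h) e; have := f_equal (fun h => snd_ ∘ h) e.
  by rewrite !fst_pair !snd_pair => <- <-; rewrite (bang_uniq u).
by apply/forces_chi; exists (bang W); rewrite pair_comp.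
Qed.

Lemma forces_transpose (X Y W : E) (g : X × Y ~> Omega) (x : W ~> X) (y : W ~> Y) :
  forces (mem X) ⟨x, transpose g ∘ y⟩ <-> forces g ⟨x, y⟩.
Proof.
by rewrite -{2}(mem_transpose g) /forces compA cross_pair comp1m.
Qed.

Lemma pow_ext (X W : E) (s t : W ~> P X) :
  (forall V (u : V ~> W) (x : V ~> X),
     forces (mem X) ⟨x, s ∘ u⟩ <-> forces (mem X) ⟨x, t ∘ u⟩) -> s = t.
Proof.
move=> eqv; rewrite (transpose_uniq (h := s) eq_refl).
symmetry; apply: transpose_uniq; apply: Omega_ext => V a.
rewrite (pair_uniq a) /forces !compA !cross_pair !comp1m; apply: iff_sym; exact: eqv.
Qed.

Lemma forces_all (Y Z : E) (phi psi : Y × Z ~> Omega) :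
  {c : Z ~> Omega | forall W (z : W ~> Z), forces c z <->
    forall V (t : V ~> W) (y : V ~> Y),
      forces phi ⟨y, z ∘ t⟩ -> forces psi ⟨y, z ∘ t⟩}.
Proof.
pose f := transpose phi; pose g := transpose (conj_ phi psi).
exists (chi (@eq_mor_mono _ _ _ f g)) => W z; rewrite forces_chi; split.
  move=> [u <-] V t y /forces_transpose; rewrite -/f -!compA eq_equalizes !compA.
  by move=> /forces_transpose/forces_conj [].
move=> sub; have [|u [eu _]] := eq_univ (f := f) (g := g) (h := z); last by exists u.
apply: pow_ext => V t y; rewrite !compA !forces_transpose forces_conj.
by split=> [h|[]//]; split=> //; apply: sub.
Qed.

Lemma forces_pow_order (X W : E) (s t : W ~> P X) :
  forces (le (pow_order X)) ⟨s, t⟩ <->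
  forall V (u : V ~> W) (x : V ~> X),
    forces (mem X) ⟨x, s ∘ u⟩ -> forces (mem X) ⟨x, t ∘ u⟩.
Proof.
have meetP V (u : V ~> W) (x : V ~> X) :
    forces (mem X) ⟨x, meet X ∘ ⟨s, t⟩ ∘ u⟩ <->
    forces (mem X) ⟨x, s ∘ u⟩ /\ forces (mem X) ⟨x, t ∘ u⟩.
  rewrite compA forces_transpose forces_conj /member /forces !compA !pair_comp.
  by rewrite !compA !(fst_pair, snd_pair).
rewrite forces_chi; split=> [[v ev] V u x|sub].
  have e : meet X ∘ ⟨s, t⟩ = s by rewrite -ev -compA eq_equalizes compA ev fst_pair.
  by rewrite -{1}e => /meetP [].
have [|v [ev _]] := eq_univ (f := meet X) (g := fst_) (h := ⟨s, t⟩); last by exists v.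
rewrite fst_pair; apply: pow_ext => V u x; rewrite meetP.
by split=> [[]//|h]; split=> //; apply: sub.
Qed.

Lemma image_char (A B : E) (f : A ~> B) :
  {c : B ~> Omega | forall W (b : W ~> B), forces c b <->
    forall V (t : V ~> W) (T : V ~> P B),
      (forall V' (t' : V' ~> V) (a : V' ~> A), forces (mem B) ⟨f ∘ a, T ∘ t'⟩) ->
      forces (mem B) ⟨b ∘ t, T⟩}.
Proof.
have [k kP] := forces_all (true_ (A × P B)) (mem B ∘ cross f (idm (P B))).
have [c cP] := forces_all (k ∘ fst_) (mem B ∘ ⟨snd_, fst_⟩ : P B × B ~> Omega).
have mP V (T : V ~> P B) (b : V ~> B) :
    forces (mem B ∘ ⟨snd_, fst_⟩) ⟨T, b⟩ <-> forces (mem B) ⟨b, T⟩.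
  by rewrite /forces compA pair_comp fst_pair snd_pair.
have kP' V (T : V ~> P B) (b : V ~> B) : forces (k ∘ fst_) ⟨T, b⟩ <->
    forall V' (t' : V' ~> V) (a : V' ~> A), forces (mem B) ⟨f ∘ a, T ∘ t'⟩.
  rewrite {1}/forces compA fst_pair -/(forces k T) kP.
  split=> h V' t' a; have := h V' t' a; rewrite /forces compA cross_pair comp1m.
    by apply; rewrite true_comp.
  by move=> ->.
exists c => W b; rewrite cP; split=> h V t T.
  by move=> /(kP' V T (b ∘ t))/h/mP.
by move=> /kP'/h/mP.
Qed.

Lemma name_sub (J B : E) (j : J ~> B) : mono j ->
  exists T : 1 ~> P B, forall W (b : W ~> B) (t : W ~> 1),
    forces (mem B) ⟨b, T ∘ t⟩ <-> exists u, j ∘ u = b.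
Proof.
move=> hj; exists (transpose (chi hj ∘ fst_)) => W b t.
by rewrite forces_transpose /forces compA fst_pair; exact: forces_chi.
Qed.

Definition image (A B : E) (f : A ~> B) : image_of f.
Proof.
have [c cP] := image_char f.
exists (eq_obj c (true_ B)) (sub_of c); first exact: eq_mor_mono.
  apply/forces_sub_of/cP => V t T h.
  by have := h V (idm V) t; rewrite compm1.
move=> J j hj [e je]; have [T TP] := name_sub hj.
have /cP h : forces c (sub_of c) by apply/forces_sub_of; exists (idm _); rewrite compm1.
have := h _ (idm _) (T ∘ bang _); rewrite compm1 => h'.
have [|u ju] := proj1 (TP _ _ _) (h' _); last by exists u.
move=> V' t' a; rewrite compA; apply/TP; exists (e ∘ a).
by rewrite -compA je.
Qed.

Definition sup_adjoint (X : E) : {j : P (P X) ~> P X |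
  internal_left_adjoint (pow_order (P X)) (pow_order X) j (down (pow_order X))}.
Proof.
have swapP (Z Y W : E) (g : Z × Y ~> Omega) (y : W ~> Y) (z : W ~> Z) :
    forces (g ∘ ⟨snd_, fst_⟩) ⟨y, z⟩ <-> forces g ⟨z, y⟩.
  by rewrite /forces compA pair_comp fst_pair snd_pair.
pose ub : P X × P (P X) ~> Omega :=
  le (pow_order (P X)) ∘ ⟨snd_, down (pow_order X) ∘ fst_⟩.
have ubP W (s : W ~> P X) (F : W ~> P (P X)) : forces ub ⟨s, F⟩ <->
    forces (le (pow_order (P X))) ⟨F, down (pow_order X) ∘ s⟩.
  by rewrite /forces /ub compA pair_comp !compA fst_pair snd_pair.
have [c cP] := forces_all (Y := P X) (Z := X × P (P X))
  (ub ∘ ⟨fst_, snd_ ∘ snd_⟩) (mem X ∘ ⟨fst_ ∘ snd_, fst_⟩).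
exists (transpose c); apply: Omega_ext => W a; rewrite (pair_uniq a).
move: (fst_ ∘ a) (snd_ ∘ a) => F s {a}.
rewrite /forces !compA !cross_pair !comp1m.
rewrite -/(forces (le (pow_order X)) _) -/(forces (le (pow_order (P X))) _).
have supP V (G : V ~> P (P X)) (x : V ~> X) :
    forces (mem X) ⟨x, transpose c ∘ G⟩ <->
    forall V' (t : V' ~> V) (S : V' ~> P X),
      forces (le (pow_order (P X))) ⟨G ∘ t, down (pow_order X) ∘ S⟩ ->
      forces (mem X) ⟨x ∘ t, S⟩.
  have e V' (t : V' ~> V) (S : V' ~> P X) :
      (ub ∘ ⟨fst_, snd_ ∘ snd_⟩) ∘ ⟨S, ⟨x, G⟩ ∘ t⟩ = ub ∘ ⟨S, G ∘ t⟩ /\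
      (mem X ∘ ⟨fst_ ∘ snd_, fst_⟩) ∘ ⟨S, ⟨x, G⟩ ∘ t⟩ = mem X ∘ ⟨x ∘ t, S⟩.
    by rewrite !compA !pair_comp !compA !(fst_pair, snd_pair).
  rewrite forces_transpose cP.
  split=> h V' t S; have := h V' t S; have [e1 e2] := e V' t S.
    by rewrite -ubP /forces e1 e2.
  by rewrite -ubP /forces e1 e2.
split=> /forces_pow_order h; apply/forces_pow_order.
  move=> V u S SF; rewrite compA forces_transpose.
  apply/forces_pow_order => V' u' x xS.
  rewrite compA; apply: h; rewrite compA; apply/supP => V'' t S'.
  move=> /forces_pow_order hS'.
  have := hS' V'' (idm _) (S ∘ u' ∘ t); rewrite !compm1 forces_transpose => hS''.
  have /hS'' /forces_pow_order hle : forces (mem (P X)) ⟨S ∘ u' ∘ t, F ∘ (u ∘ u') ∘ t⟩.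
    by have := forces_comp (u' ∘ t) SF; rewrite pair_comp !compA.
  have := hle V'' (idm _) (x ∘ t); rewrite !compm1; apply.
  by have := forces_comp t xS; rewrite pair_comp !compA.
move=> V u x; rewrite compA => /supP hx.
have := hx V (idm _) (s ∘ u); rewrite !compm1; apply.
apply/forces_pow_order => V' u' S; rewrite !compA => /h.
by rewrite !compA.
Qed.

End Existence.

Arguments image {E A B} f.

Definition sup {E : topos} (X : E) : P (P X) ~> P X := proj1_sig (sup_adjoint X).

Definition image_chi {E : topos} {A B : E} (f : A ~> B) : B ~> Omega :=
  chi (im_mono (image f)).

Definition direct_image {E : topos} {A B : E} (f : A ~> B) : P A ~> P B :=
  transpose (image_chi (cross f (idm (P A)) ∘ sub_of (mem A))).

Definition cl {E : topos} {X : E} (r : relation X) : P X ~> P X :=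
  sup X ∘ direct_image (down r).

(* The isomorphism P 1 ≅ Omega. *)
Definition pow_one {E : topos} : P (1 : E) ~> Omega := member (bang _) (idm _).

(* Quantification over the second factor; the swap is needed because
   [transpose] acts on the first factor. *)
Definition ex_ {E : topos} {Z Y : E} (psi : Z × Y ~> Omega) : Z ~> Omega :=
  pow_one ∘ direct_image (bang Y) ∘ transpose (psi ∘ ⟨snd_, fst_⟩).

(* Main.v *)
(** Direct images, existential quantifiers and the closure operator are all
    characterized impredicatively, by their elimination rule against an
    arbitrary generalized subobject.  Since [cl] is the composite of the left
    adjoints of [down] and of inverse image along [down], [cl s <= S] holds iff
    [x <= y] and [y ∈ s] always imply [x ∈ S].  This is also the universal
    property of the set of all [x] such that [∃ y, x <= y ∧ y ∈ s]. *)

From Corelib Require Import ssreflect.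
Require Import Defs.

Set Implicit Arguments.
Unset Strict Implicit.
Unset Printing Implicit Defensive.

Section ImpredicativeCharacterizations.
Variable E : topos.

Lemma forces_precomp (V Z Y : E) (phi : Z ~> Omega) (f : Y ~> Z) (a : V ~> Y) :
  forces (phi ∘ f) a <-> forces phi (f ∘ a).
Proof. by rewrite /forces compA. Qed.

Lemma forces_image (A B W : E) (f : A ~> B) (a : W ~> A) :
  forces (image_chi f) (f ∘ a).
Proof.
have [e ef] := im_factor (image f).
by apply/forces_chi; exists (e ∘ a); rewrite -compA ef.
Qed.

(** [forces c f] says that [f] factors through the subobject classified by [c], which therefore
    contains the image, the least such subobject. *)
Lemma image_le (A B W : E) (f : A ~> B) (c : B ~> Omega) (b : W ~> B) :
  forces c f -> forces (image_chi f) b -> forces c b.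
Proof.
move=> /forces_sub_of cf /forces_chi [u <-].
have [h <-] := im_least (image f) (@eq_mor_mono _ _ _ c (true_ B)) cf.
by apply/forces_sub_of; exists (h ∘ u); rewrite compA.
Qed.

(** From right to left, [T] is the direct image itself. From left to right, the quantified condition
    is internalized as a predicate on [B × P A], to which leastness of the image applies. *)
Lemma direct_imageP (A B W : E) (f : A ~> B) (s : W ~> P A) (b : W ~> B) :
  forces (mem B) ⟨b, direct_image f ∘ s⟩ <->
  forall V (t : V ~> W) (T : V ~> P B),
    (forall V' (t' : V' ~> V) (x : V' ~> A),
       forces (mem A) ⟨x, s ∘ t ∘ t'⟩ -> forces (mem B) ⟨f ∘ x, T ∘ t'⟩) ->
    forces (mem B) ⟨b ∘ t, T⟩.
Proof.
rewrite forces_transpose; split; last first.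
  move=> h; pose T := transpose (image_chi (cross f (idm (P A)) ∘ sub_of (mem A))) ∘ s.
  have := h W (idm W) T; rewrite !compm1 forces_transpose; apply.
  move=> V t x xs; rewrite compA forces_transpose.
  have [u eu] := proj1 (forces_sub_of _ _) xs.
  by rewrite -[s ∘ t]comp1m -cross_pair -eu -compA; exact: forces_image.
(* [k] at [⟨S, T⟩] says that [f] maps [S] into [T]; [c] at [⟨y, S⟩] says that [y] lies in every such
   [T]. *)
have [k kP] := forces_all (Y := A) (Z := P A × P B)
  (mem A ∘ ⟨fst_, fst_ ∘ snd_⟩) (mem B ∘ ⟨f ∘ fst_, snd_ ∘ snd_⟩).
have [c cP] := forces_all (Y := P B) (Z := B × P A)
  (k ∘ ⟨snd_ ∘ snd_, fst_⟩) (mem B ∘ ⟨fst_ ∘ snd_, fst_⟩).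
have {}kP V (S : V ~> P A) (T : V ~> P B) : forces k ⟨S, T⟩ <->
    forall V' (t : V' ~> V) (x : V' ~> A),
      forces (mem A) ⟨x, S ∘ t⟩ -> forces (mem B) ⟨f ∘ x, T ∘ t⟩.
  by rewrite kP; split=> h V' t x; have := h V' t x;
    rewrite !forces_precomp !pair_comp !compA !(fst_pair, snd_pair).
have {}cP V (y : V ~> B) (S : V ~> P A) : forces c ⟨y, S⟩ <->
    forall V' (t : V' ~> V) (T : V' ~> P B),
      forces k ⟨S ∘ t, T⟩ -> forces (mem B) ⟨y ∘ t, T⟩.
  by rewrite cP; split=> h V' t T; have := h V' t T;
    rewrite !forces_precomp !pair_comp !compA !(fst_pair, snd_pair).
move=> im V t T /kP; suff /cP cbs : forces c ⟨b, s⟩ by exact: cbs.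
apply: image_le im.
(* The inclusion [m] is the generic pair of an element and a subset containing it. *)
set m := sub_of _; have /forces_sub_of : exists u, sub_of (mem A) ∘ u = m.
  by exists (idm _); rewrite compm1.
rewrite (pair_uniq m) cross_pair comp1m => xS; apply/cP => V' t' T' /kP h.
have := h V' (idm V') (fst_ ∘ m ∘ t'); rewrite !compm1 -compA; apply.
by have := forces_comp t' xS; rewrite pair_comp.
Qed.

(** The adjunction between direct and inverse image, the latter spelled out on elements. *)
Lemma direct_image_le (A B W : E) (f : A ~> B) (s : W ~> P A) (T : W ~> P B) :
  forces (le (pow_order B)) ⟨direct_image f ∘ s, T⟩ <->
  forall V (t : V ~> W) (x : V ~> A),
    forces (mem A) ⟨x, s ∘ t⟩ -> forces (mem B) ⟨f ∘ x, T ∘ t⟩.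
Proof.
rewrite forces_pow_order; split=> h V t.
  move=> x xs; apply: h; rewrite compA; apply/direct_imageP => V' t' S hS.
  have := hS V' (idm V') (x ∘ t'); rewrite !compm1 -compA; apply.
  by have := forces_comp t' xs; rewrite pair_comp.
move=> b; rewrite compA => /direct_imageP hb.
have := hb V (idm V) (T ∘ t); rewrite !compm1; apply=> V' t' x.
by rewrite !compA; exact: h.
Qed.

(** This is [direct_imageP] along [bang Y], with subsets of [1] replaced by truth values [phi]. *)
Lemma forces_ex (Z Y W : E) (psi : Z × Y ~> Omega) (z : W ~> Z) :
  forces (ex_ psi) z <->
  forall V (t : V ~> W) (phi : V ~> Omega),
    (forall V' (t' : V' ~> V) (y : V' ~> Y),
       forces psi ⟨z ∘ t ∘ t', y⟩ -> forces phi t') ->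
    forces phi (idm V).
Proof.
have psiP V (y : V ~> Y) (x : V ~> Z) :
    forces (mem Y) ⟨y, transpose (psi ∘ ⟨snd_, fst_⟩) ∘ x⟩ <-> forces psi ⟨x, y⟩.
  by rewrite forces_transpose forces_precomp pair_comp fst_pair snd_pair.
rewrite /ex_ /pow_one /member !forces_precomp pair_comp comp1m.
rewrite direct_imageP; split=> h V t T hT.
  (* The truth value [T] as a subset of [1]. *)
  have := h V t (transpose (T ∘ snd_)).
  rewrite -[transpose (T ∘ _)]compm1 forces_transpose forces_precomp snd_pair; apply.
  move=> V' t' y; rewrite !compA psiP -compA => /hT.
  by rewrite -compA compm1 forces_transpose forces_precomp snd_pair.
have := h V t (mem 1 ∘ ⟨bang V, T⟩); rewrite forces_precomp compm1.
rewrite (bang_uniq (_ ∘ t)); apply=> V' t' y psiy.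
rewrite forces_precomp pair_comp (bang_uniq (_ ∘ t')) -(bang_uniq (bang Y ∘ y)).
by apply: hT; rewrite !compA psiP -compA.
Qed.

Lemma sup_le (X W : E) (F : W ~> P (P X)) (s : W ~> P X) :
  forces (le (pow_order X)) ⟨sup X ∘ F, s⟩ <->
  forces (le (pow_order (P X))) ⟨F, down (pow_order X) ∘ s⟩.
Proof.
have := f_equal (fun g => g ∘ ⟨F, s⟩) (proj2_sig (sup_adjoint X)).
by rewrite /forces !compA !cross_pair !comp1m => ->.
Qed.

(** By the two adjunctions, the left side says that [down r ∘ y <= S] for every [y] in [s];
    membership in [down r ∘ y] unfolds to [x <= y]. *)
Lemma cl_le (X W : E) (r : relation X) (s S : W ~> P X) :
  forces (le (pow_order X)) ⟨cl r ∘ s, S⟩ <->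
  forall V (t : V ~> W) (x y : V ~> X),
    forces (le r) ⟨x, y⟩ -> forces (mem X) ⟨y, s ∘ t⟩ ->
    forces (mem X) ⟨x, S ∘ t⟩.
Proof.
rewrite /cl compA sup_le direct_image_le; split=> h V t.
  move=> x y xy /h; rewrite compA forces_transpose => /forces_pow_order.
  move=> /(_ V (idm V) x); rewrite !compm1; apply.
  by rewrite forces_transpose.
move=> y ys; rewrite compA forces_transpose; apply/forces_pow_order => V' t' x.
rewrite !compA forces_transpose => /h; apply.
by have := forces_comp t' ys; rewrite pair_comp compA.
Qed.

End ImpredicativeCharacterizations.

Theorem corollary3p11 (E : topos) (X : E) (r : relation X)
    (W : E) (a : W ~> X) (s : W ~> P X) :
  forces (member fst_ (cl r ∘ snd_)) ⟨a, s⟩ <->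
  forces (ex_ (conj_ (leq r (fst_ ∘ fst_) snd_) (member snd_ (snd_ ∘ fst_))))
         ⟨a, s⟩.
Proof.
rewrite forces_precomp pair_comp compA fst_pair snd_pair.
set psi := conj_ _ _.
have psiP V (x : V ~> X) (S : V ~> P X) (y : V ~> X) :
    forces psi ⟨⟨x, S⟩, y⟩ <-> forces (le r) ⟨x, y⟩ /\ forces (mem X) ⟨y, S⟩.
  by rewrite forces_conj !forces_precomp !pair_comp !compA !(fst_pair, snd_pair).
split=> [acl|/forces_ex aex].
  (* [transpose (ex_ psi) ∘ s] is the set of all [x] below some member of [s]. *)
  have /forces_pow_order : forces (le (pow_order X)) ⟨cl r ∘ s, transpose (ex_ psi) ∘ s⟩.
    apply/cl_le => V t x y xy ys; rewrite compA forces_transpose.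
    apply/forces_ex => V' t' phi h.
    apply: (h V' (idm V') (y ∘ t')); rewrite compm1 pair_comp psiP -!pair_comp.
    by split; apply: forces_comp.
  by move=> /(_ W (idm W) a); rewrite !compm1 forces_transpose; apply.
(* The existential is eliminated into the truth value of [a ∈ cl s]. *)
have := aex W (idm W) (mem X ∘ ⟨a, cl r ∘ s⟩); rewrite forces_precomp !compm1; apply.
move=> V t x; rewrite pair_comp => /psiP [ax xs].
rewrite forces_precomp pair_comp.
(* Reflexivity of the order on [P X], read through [cl_le], puts everything below a member of [s]
   into [cl s]. *)
have /cl_le : forces (le (pow_order X)) ⟨cl r ∘ s, cl r ∘ s⟩.
  by apply/forces_pow_order.
by apply; [exact: ax|].
Qed.
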